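(* Let $p$ be a prime and let $\lambda,\mu$ be probability measures on $\mathbb F_p$. Then $$\sum_{b\in\mathbb F_p^*}\lambda(b)\,\|\mu*\rho_b[\mu]\|_2\ll\left(\|\lambda\|_2+\|\mu\|_2+\|\mu\|_2^{-1}p^{-1/2}\right)^{c_0/7}\|\mu\|_2,$$ where the implied constant is absolute.
   Context: $\mathbb F_p^*=\mathbb F_p\setminus\{0\}$. A probability measure on $\mathbb F_p$ is a function $f:\mathbb F_p\to\mathbb R_{\ge0}$ with $\sum_x f(x)=1$. For $f:\mathbb F_p\to\mathbb C$, $\|f\|_r=(\sum_{x\in\mathbb F_p}|f(x)|^r)^{1/r}$; $f*g(x)=\sum_{y\in\mathbb F_p}f(y)g(x-y)$; for $z\in\mathbb F_p^*$, $\rho_z[f](x)=f(x/z)$. For $A,B\subset\mathbb F_p$, $E(A,B)$ is the number of solutions of $a_1+b_1=a_2+b_2$ with $a_i\in A$, $b_i\in B$, and $bA=\{ba:a\in A\}$. Here $c_0>0$ is a fixed absolute constant (whose existence is a theorem of Bourgain) such that for every prime $p$ and all $A\subset\mathbb F_p$, $B\subset\mathbb F_p^*$ with $|A|\ge|B|$ one has $\sum_{b\in B}E(A,bA)\ll\min(p/|A|,|B|)^{-c_0}|A|^3|B|$. *)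

(* Defs.v *)
From HB Require Import structures.
From mathcomp Require Import all_boot all_order all_algebra.
From mathcomp Require Import reals exp.
Set Implicit Arguments. Unset Strict Implicit. Unset Printing Implicit Defensive.
Import Order.TTheory GRing.Theory Num.Theory.
Local Open Scope ring_scope.

Section Defs.
Variables (R : realType) (p : nat).

Definition conv (f g : 'F_p -> R) : 'F_p -> R :=
  fun x => \sum_(y : 'F_p) f y * g (x - y).

Definition rho (z : 'F_p) (f : 'F_p -> R) : 'F_p -> R := fun x => f (x / z).

Definition norm2 (f : 'F_p -> R) : R := Num.sqrt (\sum_(x : 'F_p) (f x) ^+ 2).

Definition is_prob (f : 'F_p -> R) : Prop :=
  (forall x, 0 <= f x) /\ \sum_(x : 'F_p) f x = 1.

End Defs.

Section Comb.
Variable p : nat.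
Definition energy (A B : {set 'F_p}) : nat :=
  #|[set x : ('F_p * 'F_p) * ('F_p * 'F_p) |
      [&& x.1.1 \in A, x.1.2 \in B, x.2.1 \in A, x.2.2 \in B &
          x.1.1 + x.1.2 == x.2.1 + x.2.2]]|.

Definition dil (b : 'F_p) (A : {set 'F_p}) : {set 'F_p} := [set b * a | a in A].
End Comb.

(* Main.v *)
(* Write M = ||mu||_2, let delta be the sum in brackets and eta = delta^(c0/7);
   the hypothesis forces c0 <= 1, and only delta <= 1 matters. Splitting off the
   values of mu that are at most eta^2 M^2 (small in L^2) or above M^2 / eta (small in
   L^1) costs 4 eta M by Young's inequality; what is left is at most M^2 / eta times
   the indicator of a set A with |A| <= (eta M)^-2. If |A| < (eta / M)^2 it is small
   in L^1. Otherwise put x = (eta / delta)^2: Bourgain's bound, applied to a set of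
   min(|G|, |A|) bad dilates, shows that the set G of those b for which
   E(A, bA) > K x^(-c0) |A|^3 has fewer than x elements, so lam(G) <= eta by
   Cauchy-Schwarz. Off G the energy bound gives sqrt K eta M, because
   x^(-c0) <= eta^12; this is where c0 <= 1 and the exponent c0/7 enter. *)
Require Import Defs.
From HB Require Import structures.
From mathcomp Require Import all_boot all_order all_algebra.
From mathcomp Require Import ring lra.
From mathcomp Require Import reals exp.
Import Order.TTheory GRing.Theory Num.Theory.
Local Open Scope ring_scope.

Set Implicit Arguments.
Unset Strict Implicit.
Unset Printing Implicit Defensive.

(** * Cauchy-Schwarz, the L^2 norm, dilations and Young's inequality *)

Lemma weighted_cauchy_schwarz (R : realType) (T : finType) (w u v : T -> R) :
  (forall i, 0 <= w i) ->
  (\sum_i w i * (u i * v i)) ^+ 2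
    <= (\sum_i w i * u i ^+ 2) * (\sum_i w i * v i ^+ 2).
Proof.
move=> w_ge0; rewrite -subr_ge0 -(pmulr_rge0 _ (ltr0Sn R 1)).
(* Lagrange's identity with weights: the doubled defect is a sum of non-negative terms over pairs
   (i, j). *)
have -> : 2 * ((\sum_i w i * u i ^+ 2) * (\sum_i w i * v i ^+ 2)
                - (\sum_i w i * (u i * v i)) ^+ 2)
   = \sum_i \sum_j w i * w j * (u i * v j - u j * v i) ^+ 2.
  transitivity ((\sum_i w i * u i ^+ 2) * (\sum_i w i * v i ^+ 2)
     + (\sum_i w i * v i ^+ 2) * (\sum_i w i * u i ^+ 2)
     + (\sum_i (- 2 * (w i * (u i * v i)))) * (\sum_i w i * (u i * v i))).
    by rewrite -mulr_sumr; ring.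
  rewrite !big_distrlr /= -!big_split; apply: eq_bigr => i _ /=.
  by rewrite -!big_split; apply: eq_bigr => j _ /=; ring.
apply: sumr_ge0 => i _; apply: sumr_ge0 => j _.
by rewrite mulr_ge0 ?sqr_ge0 // mulr_ge0.
Qed.

Section Norms.
Variables (R : realType) (p : nat).
Implicit Types (f g h : 'F_p -> R) (b : 'F_p) (A B : {set 'F_p}).

Lemma norm2_ge0 f : 0 <= norm2 f. Proof. exact: sqrtr_ge0. Qed.

Lemma sqr_norm2 f : norm2 f ^+ 2 = \sum_x f x ^+ 2.
Proof. by rewrite sqr_sqrtr // sumr_ge0 // => x _; rewrite sqr_ge0. Qed.

Lemma norm2_leP f (c : R) : 0 <= c -> (norm2 f <= c) = (\sum_x f x ^+ 2 <= c ^+ 2).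
Proof. by move=> c_ge0; rewrite -sqr_norm2 ler_sqr ?nnegrE ?norm2_ge0. Qed.

Lemma norm2_le f g : (forall x, 0 <= f x <= g x) -> norm2 f <= norm2 g.
Proof.
move=> fg; rewrite norm2_leP ?norm2_ge0 // sqr_norm2.
apply: ler_sum => x _; have /andP[f0 f1] := fg x.
by rewrite ler_sqr ?nnegrE // (le_trans f0).
Qed.

Lemma norm2_cauchy_schwarz f g : \sum_x f x * g x <= norm2 f * norm2 g.
Proof.
have := @weighted_cauchy_schwarz R _ (fun=> 1) f g (fun=> ler01).
under eq_bigr do rewrite mul1r.
under [X in _ <= X * _ -> _]eq_bigr do rewrite mul1r.
under [X in _ <= _ * X -> _]eq_bigr do rewrite mul1r.
rewrite -!sqr_norm2 -exprMn => le_sqr.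
by rewrite (le_trans (ler_norm _)) // -ler_sqr ?nnegrE ?mulr_ge0 ?norm2_ge0 // real_normK ?num_real.
Qed.

Lemma norm2D f g : norm2 (fun x => f x + g x) <= norm2 f + norm2 g.
Proof.
rewrite norm2_leP ?addr_ge0 ?norm2_ge0 // sqrrD !sqr_norm2.
under eq_bigr do rewrite sqrrD.
rewrite !big_split /= lerD2r lerD2l -mulr2n lerMn2r /=.
exact: norm2_cauchy_schwarz.
Qed.

Lemma norm2Z (c : R) f : 0 <= c -> norm2 (fun x => c * f x) = c * norm2 f.
Proof.
move=> c_ge0; rewrite /norm2; under eq_bigr do rewrite exprMn.
by rewrite -mulr_sumr sqrtrM ?sqr_ge0 // sqrtr_sqr ger0_norm.
Qed.

Lemma sum_rho b f : b != 0 -> \sum_x rho b f x = \sum_x f x.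
Proof.
move=> b0; rewrite [RHS](reindex_inj (mulIf (invr_neq0 b0))).
by apply: eq_bigr.
Qed.

Lemma norm2_rho b f : b != 0 -> norm2 (rho b f) = norm2 f.
Proof.
move=> b0; rewrite /norm2; congr Num.sqrt.
exact: (@sum_rho b (fun x => f x ^+ 2) b0).
Qed.

Lemma conv_ge0 f g : (forall x, 0 <= f x) -> (forall x, 0 <= g x) ->
  forall x, 0 <= conv f g x.
Proof. by move=> f0 g0 x; rewrite sumr_ge0 // => y _; rewrite mulr_ge0. Qed.

Lemma convC f g x : conv f g x = conv g f x.
Proof.
rewrite /conv (reindex_inj (subrI x)) /=.
by apply: eq_bigr => y _; rewrite mulrC opprB addrC subrK.
Qed.

Lemma norm2_convC f g : norm2 (conv f g) = norm2 (conv g f).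
Proof. by rewrite /norm2; under eq_bigr do rewrite convC. Qed.

(** Cauchy-Schwarz in y with weight [f y], against the constant 1, bounds the square of [conv f g x]
    by the mass of f times the sum of [f y * g (x - y) ^+ 2]. Summing over x first, translation
    invariance turns that sum into mass times squared norm. *)
Lemma young f g : (forall x, 0 <= f x) ->
  norm2 (conv f g) <= (\sum_x f x) * norm2 g.
Proof.
move=> f0; have sf0 : 0 <= \sum_x f x by rewrite sumr_ge0.
rewrite norm2_leP ?mulr_ge0 ?norm2_ge0 // exprMn sqr_norm2.
apply: (@le_trans _ _ (\sum_x (\sum_y f y) * (\sum_y f y * g (x - y) ^+ 2))).
  apply: ler_sum => x _.
  have := @weighted_cauchy_schwarz R _ f (fun=> 1) (fun y => g (x - y)) f0.
  rewrite /conv; under eq_bigr do rewrite mul1r.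
  by under [X in _ <= X * _ -> _]eq_bigr do rewrite expr1n mulr1.
rewrite -mulr_sumr expr2 -mulrA ler_wpM2l // exchange_big mulr_suml /=.
apply: ler_sum => y _; rewrite -mulr_sumr ler_wpM2l //.
by rewrite [X in _ <= X](reindex_inj (addIr (- y))).
Qed.

Lemma young_r f g : (forall x, 0 <= g x) ->
  norm2 (conv f g) <= norm2 f * (\sum_x g x).
Proof. by move=> g0; rewrite norm2_convC mulrC young. Qed.

(** * Indicator functions and additive energy *)

Lemma sqr_norm2_conv_indic A B :
  norm2 (conv (fun x => (x \in A)%:R) (fun x => (x \in B)%:R)) ^+ 2
    = (energy A B)%:R :> R.
Proof.
rewrite sqr_norm2 /energy -sum1dep_card natr_sum [RHS]big_mkcond /=.
under eq_bigr do rewrite /conv expr2 big_distrlr /=.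
rewrite -(pair_bigA _ (fun s t : 'F_p * 'F_p =>
  (if [&& s.1 \in A, s.2 \in B, t.1 \in A, t.2 \in B & s.1 + s.2 == t.1 + t.2]
   then 1 else 0))) /=.
rewrite -(pair_bigA _ (fun a b : 'F_p => \sum_(t : 'F_p * 'F_p)
  (if [&& a \in A, b \in B, t.1 \in A, t.2 \in B & a + b == t.1 + t.2]
   then 1 else 0))) /=.
rewrite exchange_big; apply: eq_bigr => a1 _ /=.
(* With a1 fixed, b1 is traded for the common value x = a1 + b1. *)
rewrite [RHS](reindex_inj (addIr (- a1))); apply: eq_bigr => x _ /=.
rewrite -(pair_bigA _ (fun a b : 'F_p =>
  (if [&& a1 \in A, x - a1 \in B, a \in A, b \in B & a1 + (x - a1) == a + b]
   then 1 else 0))) /=.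
(* Once x and a2 are known, the equation leaves only b2 = x - a2. *)
apply: eq_bigr => a2 _; rewrite (bigD1 (x - a2)) //= big1 ?addr0 => [|b2].
  rewrite [a1 + _]addrC [a2 + _]addrC !subrK eqxx andbT.
  by do 4!case: (_ \in _); rewrite ?mulr1 ?mulr0 ?mul0r.
rewrite eq_sym subr_eq [b2 + _]addrC [a1 + _]addrC subrK => /negbTE ->.
by rewrite !andbF.
Qed.

Lemma rho_indic b A : b != 0 -> 
  rho b (fun x => (x \in A)%:R) =1 (fun x => (x \in dil b A)%:R : R).
Proof.
move=> b0 x; rewrite /rho /dil; congr (nat_of_bool _)%:R.
apply/idP/imsetP => [xA|[a aA ->]]; first by exists (x / b); rewrite // mulrC divfK.
by rewrite mulrAC mulfV ?mul1r.
Qed.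

Lemma norm2_indic A : norm2 (fun x => (x \in A)%:R : R) = Num.sqrt #|A|%:R.
Proof.
rewrite /norm2; congr Num.sqrt; rewrite -sum1_card natr_sum [RHS]big_mkcond /=.
by apply: eq_bigr => x _; case: (_ \in _); rewrite ?expr1n ?expr0n.
Qed.

Lemma sum_set_le_norm2 f A : \sum_(x in A) f x <= norm2 f * Num.sqrt #|A|%:R.
Proof.
rewrite -norm2_indic (le_trans _ (norm2_cauchy_schwarz _ _)) // [X in X <= _]big_mkcond.
by apply: ler_sum => x _; case: (_ \in _); rewrite ?mulr1 ?mulr0.
Qed.

(** * Level sets of a probability measure and convolutions of the pieces *)

Lemma norm2_prob_gt0 f : is_prob f -> 0 < norm2 f.
Proof.
move=> [f0 f1]; rewrite lt_neqAle norm2_ge0 andbT eq_sym; apply/negP => /eqP n0.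
have := sum_set_le_norm2 f [set: 'F_p]; rewrite n0 mul0r.
by under eq_bigl do rewrite in_setT; rewrite f1 ler10.
Qed.

(** Three Markov-type estimates for cuts at lo = eta^2 M^2 and hi = M^2 / eta, M the norm: f1^2 <=
    lo f sums to lo, hi f3 <= f^2 sums to M^2 = hi eta, and f > lo on A gives |A| lo <= 1. *)
Lemma level_decomposition f (eta : R) : is_prob f -> 0 < eta ->
  exists (f1 f2 f3 : 'F_p -> R) (A : {set 'F_p}),
  [/\ forall x, f x = f1 x + f2 x + f3 x,
      [/\ forall x, 0 <= f1 x, forall x, 0 <= f2 x & forall x, 0 <= f3 x],
      norm2 f1 <= eta * norm2 f /\ \sum_x f3 x <= eta,
      forall x, f2 x <= norm2 f ^+ 2 / eta * (x \in A)%:R &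
      #|A|%:R * (eta ^+ 2 * norm2 f ^+ 2) <= 1].
Proof.
move=> fP eta0; have [f0 f1] := fP; have M0 := norm2_prob_gt0 fP.
set M := norm2 f in M0 *; set lo := eta ^+ 2 * M ^+ 2; set hi := M ^+ 2 / eta.
have hi0 : 0 < hi by rewrite divr_gt0 ?exprn_gt0.
(* The test [f x > lo] in the third piece keeps the pieces disjoint even when lo > hi, which happens
   for eta > 1. *)
exists (fun x => if f x <= lo then f x else 0),
  (fun x => if (f x > lo) && (f x <= hi) then f x else 0),
  (fun x => if (f x > lo) && (f x > hi) then f x else 0), [set x | f x > lo].
split.
- move=> x; case: (leP (f x) lo); case: (leP (f x) hi);
    by rewrite ?(addr0, add0r).
- by split=> x; case: ifP.
- split.
    rewrite norm2_leP ?mulr_ge0 ?(ltW eta0) ?(ltW M0) // exprMn -/lo.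
    rewrite -[X in _ <= X]mulr1 -f1 mulr_sumr; apply: ler_sum => x _.
    case: ifP => [le_lo|_]; first by rewrite expr2 ler_wpM2r.
    by rewrite expr0n mulr_ge0 // mulr_ge0 ?sqr_ge0.
  have hiE : hi * eta = \sum_x f x ^+ 2 by rewrite divfK ?gt_eqF // sqr_norm2.
  rewrite -(ler_pM2l hi0) hiE mulr_sumr.
  apply: ler_sum => x _; case: ifP => [/andP[_ /ltW gt_hi]|_].
    by rewrite expr2 ler_wpM2r.
  by rewrite mulr0 sqr_ge0.
- move=> x; rewrite inE; case: (ltP lo (f x)) => _; last by rewrite mulr0.
  by rewrite mulr1; case: (leP (f x) hi) => // _; rewrite ltW.
- rewrite -[X in _ <= X]f1 mulr_natl -sumr_const -/lo [X in _ <= X](bigID (mem [set x | f x > lo])) /=.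
  rewrite -[X in X <= _]addr0 lerD ?sumr_ge0 //.
  by apply: ler_sum => x; rewrite inE => /ltW.
Qed.

Lemma norm2_conv_rho_le f b : b != 0 -> is_prob f ->
  norm2 (conv f (rho b f)) <= norm2 f.
Proof.
by move=> b0 [f0 f1]; rewrite (le_trans (young _ _)) // f1 mul1r norm2_rho.
Qed.

(** The left factor is expanded first, and the right one only against [f2]. This leaves four error
    terms: Young's inequality pairs [f1], small in L^2, with a mass at most 1, and [f3], small in
    L^1, with an L^2 norm at most [norm2 f]. *)
Lemma norm2_conv_rho_split f f1 f2 f3 b (c e : R) :
  b != 0 -> is_prob f -> (forall x, f x = f1 x + f2 x + f3 x) ->
  (forall x, 0 <= f1 x) -> (forall x, 0 <= f2 x) -> (forall x, 0 <= f3 x) ->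
  norm2 f1 <= c -> \sum_x f3 x <= e ->
  norm2 (conv f (rho b f))
    <= norm2 (conv f2 (rho b f2)) + 2 * c + 2 * (e * norm2 f).
Proof.
move=> b0 [f_ge0 f_sum] fE f1_ge0 f2_ge0 f3_ge0 f1c f3e.
have c0 : 0 <= c := le_trans (norm2_ge0 _) f1c.
have f2_le x : 0 <= f2 x <= f x.
  by rewrite f2_ge0 fE -addrA addrCA lerDl addr_ge0.
have f2_sum : \sum_x f2 x <= 1.
  by rewrite -f_sum ler_sum // => x _; have /andP[] := f2_le x.
have rho_ge0 g : (forall x, 0 <= g x) -> forall x, 0 <= rho b g x.
  by move=> g0 x; apply: g0.
pose t1 := conv f1 (rho b f); pose t2 := conv f3 (rho b f).
pose t3 := conv f2 (rho b f1); pose t4 := conv f2 (rho b f3).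
pose t0 := conv f2 (rho b f2).
have : norm2 (conv f (rho b f)) <=
    norm2 (fun x => t0 x + (t1 x + (t2 x + (t3 x + t4 x)))).
  apply: norm2_le => x; rewrite conv_ge0 ?f_ge0 //=; last exact: rho_ge0.
  rewrite /t0 /t1 /t2 /t3 /t4 /conv -!big_split /= ler_sum // => y _.
  by rewrite /rho !fE; lra.
move/le_trans; apply.
have l1 : norm2 t1 <= c.
  by rewrite (le_trans (young_r _ _)) ?sum_rho ?f_sum ?mulr1 //; apply: rho_ge0.
have l2 : norm2 t2 <= e * norm2 f.
  by rewrite (le_trans (young _ _)) // norm2_rho // ler_wpM2r ?norm2_ge0.
have l3 : norm2 t3 <= c.
  rewrite (le_trans (young _ _)) // norm2_rho // -[c]mul1r.
  by rewrite ler_pM ?sumr_ge0 ?norm2_ge0.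
have l4 : norm2 t4 <= e * norm2 f.
  rewrite (le_trans (young_r _ _)) ?sum_rho //; first exact: rho_ge0.
  by rewrite mulrC ler_pM ?sumr_ge0 ?norm2_ge0 // norm2_le.
have := norm2D t0 (fun x => t1 x + (t2 x + (t3 x + t4 x))).
have := norm2D t1 (fun x => t2 x + (t3 x + t4 x)).
have := norm2D t2 (fun x => t3 x + t4 x).
have := norm2D t3 t4.
rewrite -/t0; lra.
Qed.

(** Pointwise the convolution is at most h^2 times that of the indicators of A and bA, whose squared
    norm is the energy. *)
Lemma norm2_conv_rho_energy f (h : R) A b : b != 0 -> 0 <= h ->
  (forall x, 0 <= f x <= h * (x \in A)%:R) ->
  norm2 (conv f (rho b f)) <= h ^+ 2 * Num.sqrt (energy A (dil b A))%:R.
Proof.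
move=> b0 h0 fA; rewrite -sqr_norm2_conv_indic sqrtr_sqr ger0_norm ?norm2_ge0 //.
rewrite -norm2Z ?sqr_ge0 //; apply: norm2_le => x.
have f0 y : 0 <= f y by have /andP[] := fA y.
rewrite conv_ge0 //=; last by move=> y; apply: f0.
rewrite /conv mulr_sumr ler_sum // => y _.
have /andP[_ fy] := fA y; have /andP[_ fxy] := fA ((x - y) / b).
rewrite -(rho_indic A b0) /rho expr2 mulrACA.
exact: ler_pM (f0 _) (f0 _) fy fxy.
Qed.

Lemma card_dil b A : b != 0 -> #|dil b A| = #|A|.
Proof. by move=> b0; rewrite card_imset //; apply: mulfI. Qed.

(** The diagonal solutions a1 = a2, b1 = b2 already suffice. *)
Lemma energy_ge A B : (#|A| * #|B| <= energy A B)%N.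
Proof.
rewrite -cardsX -(card_imset _ (_ : injective (fun q : 'F_p * 'F_p => (q, q)))).
  apply/subset_leq_card/subsetP => _ /imsetP[[a b] /setXP[aA bB] ->].
  by rewrite inE /= aA bB eqxx.
by move=> q r [].
Qed.

End Norms.

(** * Consequences of Bourgain's energy bound *)

Lemma exists_subset_card (T : finType) (A : {set T}) (n : nat) :
  (n <= #|A|)%N -> exists2 B : {set T}, B \subset A & #|B| = n.
Proof.
move=> /card_geqP[s [s_uniq <- sA]]; exists [set:: s].
  by apply/subsetP => x; rewrite inE => /sA.
by rewrite cardsE; apply/card_uniqP.
Qed.

Lemma powRN_le (R : realType) (c x y : R) : 0 <= c -> 0 < x -> x <= y ->
  y `^ (- c) <= x `^ (- c).
Proof.
move=> c0 x0 xy; rewrite !powRN lef_pV2 ?posrE ?powR_gt0 ?(lt_le_trans x0) //.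
by rewrite ge0_ler_powR // nnegrE ltW ?(lt_le_trans x0).
Qed.

(** Given at least x bad dilates, trim them to a set B of size min(|G|, |A|): it is admissible in
    the energy bound and, as x <= |A|, still has at least x elements. The minimum in that bound is
    then at least x, so the energies over B average at most the threshold that each of them strictly
    exceeds. *)
Lemma few_bad_dilates (R : realType) (p : nat) (c0 K x : R) (A : {set 'F_p}) :
  0 < c0 -> 0 <= K -> 0 < x -> x <= p%:R / #|A|%:R -> x <= #|A|%:R ->
  (forall B : {set 'F_p}, (#|B| <= #|A|)%N -> 0 \notin B ->
     \sum_(b in B) ((energy A (dil b A))%:R : R)
       <= K * (Num.min (p%:R / #|A|%:R) #|B|%:R) `^ (- c0)
            * #|A|%:R ^+ 3 * #|B|%:R) ->
  #|[set b : 'F_p | (b != 0) &&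
      (K * x `^ (- c0) * #|A|%:R ^+ 3 < (energy A (dil b A))%:R)]|%:R < x.
Proof.
move=> c00 K0 x0 xp xA bourgain; rewrite ltNge; apply/negP => xG.
set s := K * _ * _ in xG; set G := [set b | _] in xG.
have [B /subsetP BG cardB] := exists_subset_card (geq_minl #|G| #|A|).
have xB : x <= #|B|%:R.
  by rewrite cardB; case: (leqP #|G| #|A|) => /= _.
have : \sum_(b in B) s < \sum_(b in B) ((energy A (dil b A))%:R : R).
  apply: ltr_sum => [|b /BG]; last by rewrite inE => /andP[].
  have : (0 < #|B|)%N by rewrite -(ltr_nat R) (lt_le_trans x0).
  by move=> /card_gt0P[b bB]; apply/hasP; exists b; rewrite ?mem_index_enum.
rewrite sumr_const -mulr_natr ltNge => /negP; apply.
apply: le_trans (bourgain B _ _) _; first by rewrite cardB geq_minr.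
  by apply/negP => /BG; rewrite inE eqxx.
rewrite ler_wpM2r // ler_wpM2r ?exprn_ge0 // ler_wpM2l //.
by rewrite powRN_le ?(ltW c00) // le_min xp.
Qed.

(* Count only the diagonal solutions, for [n]-element sets with [n ^ 2 < p]. *)
Lemma bourgain_exponent_le1 (R : realType) (c0 K : R) : 
  (forall (p : nat), prime p ->
     forall (A B : {set 'F_p}), (0 < #|A|)%N -> (#|B| <= #|A|)%N -> 0 \notin B ->
       \sum_(b in B) ((energy A (dil b A))%:R : R)
         <= K * (Num.min (p%:R / #|A|%:R) #|B|%:R) `^ (- c0)
              * #|A|%:R ^+ 3 * #|B|%:R) ->
  c0 <= 1.
Proof.
move=> bourgain; rewrite leNgt; apply/negP => c1.
(* With |A| = |B| = n and p > n^2 the minimum is n, and the diagonal gives n^3 <= K n^(-c0) n^4. *)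
have bound n : (0 < n)%N -> n%:R `^ (c0 - 1) <= K.
  move=> n0; have n0R : 0 < n%:R :> R by rewrite ltr0n.
  have [p np p_prime] := prime_above (n ^ 2).
  have n_lt_p : (n < p)%N by rewrite (leq_ltn_trans _ np) // -mulnn leq_pmulr.
  have [A _ cardA] : exists2 A : {set 'F_p}, A \subset setT & #|A| = n.
    by apply: exists_subset_card; rewrite cardsT card_Fp // ltnW.
  have [B /subsetP B0 cardB] : exists2 B : {set 'F_p}, B \subset ~: [set 0] & #|B| = n.
    apply: exists_subset_card; rewrite cardsC1 card_Fp //.
    by rewrite -ltnS prednK // prime_gt0.
  have nB b : b \in B -> b != 0 by move=> /B0; rewrite !inE.
  have := bourgain p p_prime A B; rewrite cardA cardB => /(_ n0 (leqnn _)).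
  have -> : 0 \notin B by apply/negP => /nB; rewrite eqxx.
  move=> /(_ isT); have -> : Num.min (p%:R / n%:R) n%:R = n%:R :> R.
    by rewrite min_r // ler_pdivlMr // -natrM ler_nat ltnW.
  have : \sum_(b in B) (n ^ 2)%:R <= \sum_(b in B) ((energy A (dil b A))%:R : R).
    apply: ler_sum => b /nB b0; rewrite ler_nat.
    by rewrite (leq_trans _ (energy_ge _ _)) // card_dil // cardA.
  rewrite sumr_const cardB => lo /(le_trans lo); rewrite -[X in X <= _]mulr_natr.
  rewrite ler_pM2r // natrX [_ ^+ 3]exprS [X in _ <= X]mulrA -[X in X <= _]mul1r.
  rewrite ler_pM2r ?exprn_gt0 //.
  move=> /(ler_wpM2r (powR_ge0 n%:R (c0 - 1))); rewrite mul1r => /le_trans; apply.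
  have n_neq0 : n%:R != 0 :> R by rewrite gt_eqF.
  have npow_neq0 : n%:R `^ c0 != 0 by rewrite gt_eqF ?powR_gt0.
  rewrite powRN powRB ?n_neq0 ?implybT // powRr1 ?(ltW n0R) //.
  by rewrite le_eqVlt; apply/orP; left; apply/eqP; field; apply/andP.
have K0 : 0 < K by rewrite (lt_le_trans _ (bound 1%N isT)) // powR_gt0.
have e0 : 0 < c0 - 1 by rewrite subr_gt0.
(* This n exceeds (K + 1)^(1/(c0 - 1)), so n^(c0 - 1) >= K + 1 contradicts [bound]. *)
pose n := (Num.truncn ((K + 1) `^ (c0 - 1)^-1)).+1.
have : K + 1 <= n%:R `^ (c0 - 1).
  have -> : K + 1 = ((K + 1) `^ (c0 - 1)^-1) `^ (c0 - 1).
    by rewrite -powRrM mulVf ?lt0r_neq0 // powRr1 // addr_ge0 // ltW.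
  by rewrite ge0_ler_powR ?(ltW e0) ?nnegrE ?powR_ge0 // ltW // truncnS_gt.
by move=> /le_trans /(_ (bound n isT)); rewrite gerDl ler10.
Qed.


(** * Exceptional dilates and the final estimate *)

Lemma sum_le_sqrt_card (R : realType) (p : nat) (f : 'F_p -> R)
    (A : {set 'F_p}) (c x : R) :
  norm2 f <= c -> 0 <= x -> #|A|%:R <= x ^+ 2 -> \sum_(b in A) f b <= c * x.
Proof.
move=> fc x0 Ax; rewrite (le_trans (sum_set_le_norm2 _ _)) //.
rewrite ler_pM ?norm2_ge0 ?sqrtr_ge0 //.
by rewrite -(ger0_norm x0) -sqrtr_sqr ler_wsqrtr.
Qed.

(** [delta] and [eta] are free parameters here: the third summand of the bracket enters as the lower
    bound on p, and the exponent c0/7 only through the inequality with [eta ^+ 12]. *)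
Lemma exceptional_dilates (R : realType) (p : nat) (c0 K delta eta : R)
    (lam mu : 'F_p -> R) :
  0 < c0 -> 0 <= K -> 0 < delta -> 0 < eta ->
  is_prob mu -> norm2 lam <= delta -> norm2 mu <= delta ->
  1 <= delta ^+ 2 * norm2 mu ^+ 2 * p%:R ->
  ((eta / delta) ^+ 2) `^ (- c0) <= eta ^+ 12 ->
  (forall A B : {set 'F_p}, (0 < #|A|)%N -> (#|B| <= #|A|)%N -> 0 \notin B ->
     \sum_(b in B) ((energy A (dil b A))%:R : R)
       <= K * (Num.min (p%:R / #|A|%:R) #|B|%:R) `^ (- c0)
            * #|A|%:R ^+ 3 * #|B|%:R) ->
  exists2 G : {set 'F_p}, \sum_(b in G) lam b <= eta &
    forall b, b != 0 -> b \notin G ->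
      norm2 (conv mu (rho b mu)) <= (5 + Num.sqrt K) * (eta * norm2 mu).
Proof.
move=> c0_gt0 K_ge0 delta0 eta0 muP lam_le mu_le large_p x_pow bourgain.
have [mu_ge0 _] := muP; have M0 := norm2_prob_gt0 muP.
have [f1 [f2 [f3 [A [fE [f1_ge0 f2_ge0 f3_ge0] [f1_le f3_le] f2_le cardA]]]]] :=
  level_decomposition muP eta0.
set M := norm2 mu in mu_le large_p M0 f1_le f2_le cardA *.
have f2_mu x : 0 <= f2 x <= mu x.
  by rewrite f2_ge0 fE -addrA addrCA lerDl addr_ge0.
(* Splitting costs 2 eta M for f1 and 2 eta M for f3, which turns 1 into 5. *)
suff [G lamG boundG] : exists2 G : {set 'F_p}, \sum_(b in G) lam b <= eta &
    forall b, b != 0 -> b \notin G ->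
      norm2 (conv f2 (rho b f2)) <= (1 + Num.sqrt K) * (eta * M).
  exists G => // b b0 bG.
  have := norm2_conv_rho_split b0 muP fE f1_ge0 f2_ge0 f3_ge0 f1_le f3_le.
  by have := boundG b b0 bG; rewrite -/M; lra.
have eM0 : 0 < eta * M by rewrite mulr_gt0.
have [A_small|A_large] := leP #|A|%:R ((eta / M) ^+ 2).
  exists set0 => [|b b0 _]; first by rewrite big_set0 ltW.
  have f2_sum : \sum_x f2 x <= eta.
    have -> : eta = M * (eta / M) by rewrite mulrCA mulfV ?mulr1 ?gt_eqF.
    have e0 : 0 <= eta / M by rewrite divr_ge0 // ltW.
    apply: le_trans (sum_le_sqrt_card (lexx M) e0 A_small).
    rewrite [X in _ <= X]big_mkcond ler_sum // => x _.
    have := f2_le x; have /andP[_ f2_mux] := f2_mu x.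
    by case: (x \in A) => //; rewrite mulr0.
  rewrite (le_trans (young _ _)) // norm2_rho //.
  apply: (@le_trans _ _ (eta * M)).
    by rewrite ler_pM ?sumr_ge0 ?norm2_ge0 // norm2_le.
  by rewrite mulrDl mul1r lerDl mulr_ge0 ?sqrtr_ge0 // ltW.
set x := (eta / delta) ^+ 2 in x_pow.
have x0 : 0 < x by rewrite exprn_gt0 ?divr_gt0.
have cardA0 : 0 < #|A|%:R :> R by rewrite (lt_trans _ A_large) ?exprn_gt0 ?divr_gt0.
have xA : x <= #|A|%:R.
  rewrite (le_trans _ (ltW A_large)) // ler_sqr ?nnegrE ?divr_ge0 ?(ltW eta0) ?(ltW delta0) ?(ltW M0) //.
  by rewrite ler_pM2l // lef_pV2 ?posrE.
(* Since |A| <= (eta M)^(-2), x |A| is at most (delta M)^(-2), hence at most p by [large_p]. *)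
have xp : x <= p%:R / #|A|%:R.
  rewrite ler_pdivlMr // /x expr_div_n mulrAC ler_pdivrMr ?exprn_gt0 //.
  rewrite -(ler_pM2r (exprn_gt0 2 M0)) mulrAC [eta ^+ 2 * _ * _]mulrC.
  by rewrite mulrAC in large_p *; lra.
set s := K * x `^ (- c0) * #|A|%:R ^+ 3.
exists [set b : 'F_p | (b != 0) && (s < (energy A (dil b A))%:R)] => [|b b0].
  have -> : eta = delta * (eta / delta) by rewrite mulrCA mulfV ?mulr1 ?gt_eqF.
  apply: sum_le_sqrt_card; rewrite ?divr_ge0 // ?ltW //.
  apply: few_bad_dilates => // B BA; apply: bourgain => //.
  by rewrite -(ltr_nat R).
rewrite inE b0 /= -leNgt => E_le.
have h0 : 0 <= M ^+ 2 / eta by rewrite divr_ge0 ?sqr_ge0 ?ltW.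
have f2A y : 0 <= f2 y <= M ^+ 2 / eta * (y \in A)%:R by rewrite f2_ge0 f2_le.
apply: le_trans (norm2_conv_rho_energy b0 h0 f2A) _.
(* eta^12 against |A|^3 <= (eta M)^(-6) leaves eta^6 / M^6; its root times (M^2 / eta)^2 is exactly
   eta M. *)
have s_le : s <= K * (eta ^+ 3 / M ^+ 3) ^+ 2.
  rewrite /s -mulrA ler_wpM2l //.
  have /(lerXn2r 3) : #|A|%:R <= (eta ^+ 2 * M ^+ 2)^-1.
    by rewrite -[_^-1]mul1r ler_pdivlMr ?mulr_gt0 ?exprn_gt0.
  rewrite !nnegrE invr_ge0 mulr_ge0 ?sqr_ge0 // ltW // => /(_ isT isT) cube_le.
  have := ler_pM (powR_ge0 x (- c0)) (exprn_ge0 3 (ltW cardA0)) x_pow cube_le.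
  move=> /le_trans; apply; rewrite le_eqVlt; apply/orP; left; apply/eqP.
  by field; rewrite !gt_eqF.
have sqrt_le : Num.sqrt (energy A (dil b A))%:R <= Num.sqrt K * (eta ^+ 3 / M ^+ 3).
  have e0 : 0 <= eta ^+ 3 / M ^+ 3 by rewrite divr_ge0 ?exprn_ge0 ?ltW.
  rewrite -[X in _ * X](ger0_norm e0) -sqrtr_sqr -sqrtrM // ler_wsqrtr //.
  exact: le_trans E_le s_le.
apply: (@le_trans _ _ (Num.sqrt K * (eta * M))); last first.
  by rewrite ler_wpM2r ?(ltW eM0) // lerDr ler01.
have -> : Num.sqrt K * (eta * M)
    = (M ^+ 2 / eta) ^+ 2 * (Num.sqrt K * (eta ^+ 3 / M ^+ 3)).
  by field; rewrite !gt_eqF.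
by rewrite ler_wpM2l ?sqr_ge0.
Qed.

Theorem theorem4 (R : realType) (c0 : R) (hc0 : 0 < c0)
  (bourgain : exists K : R, forall (p : nat), prime p ->
     forall (A B : {set 'F_p}), (0 < #|A|)%N -> (#|B| <= #|A|)%N -> 0 \notin B ->
       \sum_(b in B) ((energy A (dil b A))%:R : R)
         <= K * (Num.min (p%:R / #|A|%:R) #|B|%:R) `^ (- c0)
              * #|A|%:R ^+ 3 * #|B|%:R) :
  exists C : R, forall (p : nat), prime p ->
    forall (lam mu : 'F_p -> R), is_prob lam -> is_prob mu ->
      \sum_(b : 'F_p | b != 0) lam b * norm2 (conv mu (rho b mu))
        <= C * (norm2 lam + norm2 mu + (norm2 mu)^-1 * (p%:R) `^ (- (1 / 2)))
                 `^ (c0 / 7) * norm2 mu.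
Proof.
case: bourgain => K bourgain.
have c0_le1 := bourgain_exponent_le1 bourgain.
(* 5 + sqrt |K| comes from the good dilates, 1 from the exceptional set. *)
exists (6 + Num.sqrt `|K|) => p p_prime lam mu lamP muP.
have [lam_ge0 lam_sum] := lamP; have M0 := norm2_prob_gt0 muP.
set M := norm2 mu in M0 *; set delta := norm2 lam + M + _; set eta := delta `^ _.
have p0 : 0 < p%:R :> R by rewrite ltr0n prime_gt0.
have q0 : 0 < M^-1 * p%:R `^ (- (1 / 2)) by rewrite mulr_gt0 ?invr_gt0 ?powR_gt0.
have lam0 := norm2_ge0 lam.
have lam_le : norm2 lam <= delta by rewrite /delta; lra.
have M_le : M <= delta by rewrite /delta; lra.
have q_le : M^-1 * p%:R `^ (- (1 / 2)) <= delta by rewrite /delta; lra.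
have delta0 : 0 < delta := lt_le_trans M0 M_le.
have eta0 : 0 < eta by rewrite powR_gt0.
have K_ge0 := sqrtr_ge0 `|K|.
have [G lamG boundG] : exists2 G : {set 'F_p}, \sum_(b in G) lam b <= eta &
    forall b, b != 0 -> b \notin G ->
      norm2 (conv mu (rho b mu)) <= (5 + Num.sqrt `|K|) * (eta * M).
  (* For delta >= 1 also eta >= 1, and the trivial bound M suffices. *)
  have [delta_ge1|/ltW delta_le1] := leP 1 delta.
    exists set0 => [|b b0 _]; first by rewrite big_set0 ltW.
    rewrite (le_trans (norm2_conv_rho_le b0 muP)) // mulrA -[X in X <= _]mul1r.
    rewrite ler_wpM2r ?(ltW M0) //.
    have : 1 <= eta by rewrite -(powRr0 delta) ler_powR // divr_ge0 // ltW.
    by nra.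
  apply: (@exceptional_dilates _ _ c0 `|K| delta) => //.
  - have : 1 <= (delta * (M * p%:R `^ (1 / 2))) ^+ 2.
      rewrite -[X in X <= _](expr1n _ 2) ler_sqr ?nnegrE ?mulr_ge0 ?powR_ge0 ?(ltW delta0) ?(ltW M0) //.
      rewrite -ler_pdivrMr ?mulr_gt0 ?powR_gt0 // invfM -powRN.
      by rewrite [1 * (_ * _)]mul1r.
    have sqrt_p : (p%:R `^ (1 / 2)) ^+ 2 = p%:R :> R.
      by rewrite -powR_mulrn ?powR_ge0 // -powRrM divfK ?powRr1 ?(ltW p0) // pnatr_eq0.
    by rewrite !exprMn sqrt_p mulrA.
  - have -> : (eta / delta) ^+ 2 = delta `^ ((c0 / 7 - 1) * 2).
      by rewrite powRrM powRB ?(gt_eqF delta0) ?implybT // powRr1 ?(ltW delta0) // powR_mulrn ?divr_ge0 ?ltW.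
    rewrite -powR_mulrn ?(ltW eta0) // -!powRrM.
    (* As delta <= 1, exponents compare in reverse: 2 c0 (1 - c0/7) >= 12 c0/7 amounts to c0 <=
       1. *)
    by rewrite ger_powR ?delta0 //; nra.
  - move=> A B A0 BA B0; apply: (le_trans (bourgain p p_prime A B A0 BA B0)).
    by rewrite !ler_wpM2r ?exprn_ge0 ?powR_ge0 ?ler_norm.
(* On G: lam-mass at most eta and trivial norm bound M. Off G: total mass 1 and the uniform
   bound. *)
rewrite (bigID (mem G)) /= -mulrA.
have -> : (6 + Num.sqrt `|K|) * (eta * M)
    = eta * M + (5 + Num.sqrt `|K|) * (eta * M) by ring.
apply: lerD.
  apply: (@le_trans _ _ (\sum_(b in G) lam b * M)); last first.
    by rewrite -mulr_suml ler_wpM2r // ltW.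
  rewrite big_andbC big_mkcondr /= ler_sum // => b bG.
  case: ifP => b0; last by rewrite mulr_ge0 // ltW.
  by rewrite ler_wpM2l // norm2_conv_rho_le.
set T := _ * (eta * M); rewrite -[X in _ <= X]mul1r -lam_sum mulr_suml.
rewrite big_mkcond ler_sum // => b _; case: ifP => [/andP[b0 bG]|_].
  by rewrite ler_wpM2l // boundG.
by rewrite mulr_ge0 // mulr_ge0 ?addr_ge0 // mulr_ge0 ?ltW.
Qed.
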